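(* Let $\mathcal{F}$ be a finite subcollection of $\mathcal{M}(\mathbb{D})$. A composition sequence $F_n=f_1\cdots f_n$ generated by $\mathcal{F}$ is of limit-disc type if and only if both of the following hold: (i) $\alpha_{f_{n-1}}=\beta_{f_n}$ for all but finitely many positive integers $n$; (ii) $\displaystyle\sum_{n=1}^\infty \gamma_{f_1}\gamma_{f_2}\cdots\gamma_{f_n}<+\infty$.
   Context: $\mathbb{D}$ is the open unit disc. $\mathcal{M}(\mathbb{D})$ denotes the set of Möbius transformations $f$ of $\overline{\mathbb{C}}$ with $f(\mathbb{D})\subset\mathbb{D}$ and $f(\mathbb{D})\neq\mathbb{D}$. A composition sequence generated by $\mathcal{F}$ is $(F_n)$ with $F_n=f_1\cdots f_n$, each $f_i\in\mathcal{F}$; it is of limit-disc type if $\bigcap_n F_n(\overline{\mathbb{D}})$ is a closed disc of positive radius (rather than a single point). For $f\in\mathcal{M}(\mathbb{D})$: either $f(\mathbb{D})$ is internally tangent to $\mathbb{D}$ at a unique point, in which case $\alpha_f,\beta_f$ are the unique points of $\partial\mathbb{D}$ with $f(\alpha_f)=\beta_f$; or $\partial f(\mathbb{D})\cap\partial\mathbb{D}=\emptyset$, in which case $\alpha_f=0$ and $\beta_f=\infty$. Define $\gamma_f=1/|f'(\alpha_f)|$. *)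

(* Defs.v *)
From Stdlib Require Import Reals Lra List Classical ClassicalEpsilon.
Open Scope R_scope.

Definition C := (R * R)%type.
Definition C0 : C := (0, 0).
Definition Cadd (z w : C) : C := (fst z + fst w, snd z + snd w).
Definition Copp (z : C) : C := (- fst z, - snd z).
Definition Csub (z w : C) : C := Cadd z (Copp w).
Definition Cmul (z w : C) : C :=
  (fst z * fst w - snd z * snd w, fst z * snd w + snd z * fst w).
Definition Cinv (z : C) : C :=
  let n := fst z * fst z + snd z * snd z in (fst z / n, - snd z / n).
Definition Cdiv (z w : C) : C := Cmul z (Cinv w).
Definition Cmod (z : C) : R := sqrt (fst z * fst z + snd z * snd z).

Definition Ceq_dec (z w : C) : {z = w} + {z <> w}.
Proof.
  destruct z as [x y], w as [u v].
  destruct (Req_EM_T x u) as [H1|H1]; destruct (Req_EM_T y v) as [H2|H2];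
    subst; [left; reflexivity | right | right | right]; congruence.
Defined.

(** Points of the Riemann sphere: [None] is infinity. *)
Definition Chat := option C.

Record mob := Mob { ma : C; mb : C; mc : C; md : C }.

Definition mob_det (f : mob) : C := Csub (Cmul (ma f) (md f)) (Cmul (mb f) (mc f)).

Definition mob_app (f : mob) (z : Chat) : Chat :=
  match z with
  | Some z =>
      let den := Cadd (Cmul (mc f) z) (md f) in
      if Ceq_dec den C0 then None
      else Some (Cdiv (Cadd (Cmul (ma f) z) (mb f)) den)
  | None =>
      if Ceq_dec (mc f) C0 then None else Some (Cdiv (ma f) (mc f))
  end.

Definition mob_deriv (f : mob) (z : C) : C :=
  let den := Cadd (Cmul (mc f) z) (md f) in Cdiv (mob_det f) (Cmul den den).

Definition in_MD (f : mob) : Prop :=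
  mob_det f <> C0 /\
  (forall z, Cmod z < 1 -> exists w, mob_app f (Some z) = Some w /\ Cmod w < 1) /\
  (exists w, Cmod w < 1 /\ ~ (exists z, Cmod z < 1 /\ mob_app f (Some z) = Some w)).

(** ∂f(D) = f(∂D) meets ∂D (internal tangency case). *)
Definition tangent (f : mob) : Prop :=
  exists a b : C, Cmod a = 1 /\ Cmod b = 1 /\ mob_app f (Some a) = Some b.

Definition ab_spec (f : mob) (p : C * Chat) : Prop :=
  match p with
  | (a, Some b) => Cmod a = 1 /\ Cmod b = 1 /\ mob_app f (Some a) = Some b
  | (_, None) => False
  end.

Definition inhab_ab : inhabited (C * Chat) := inhabits (C0, None).

Definition alpha_beta (f : mob) : C * Chat :=
  match excluded_middle_informative (tangent f) with
  | left _ => epsilon inhab_ab (ab_spec f)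
  | right _ => (C0, None)
  end.

Definition alpha (f : mob) : C := fst (alpha_beta f).
Definition beta (f : mob) : Chat := snd (alpha_beta f).

Definition gamma (f : mob) : R := / Cmod (mob_deriv f (alpha f)).

(** F_n(z) = f_1 ( f_2 ( ... f_n (z))) ; f 0 is unused. *)
Fixpoint comp_app (f : nat -> mob) (n : nat) (z : Chat) : Chat :=
  match n with
  | O => z
  | S k => comp_app f k (mob_app (f (S k)) z)
  end.

Definition limit_disc (f : nat -> mob) : Prop :=
  exists (c : C) (r : R), 0 < r /\
    forall w : C,
      (forall n, (1 <= n)%nat ->
         exists z, Cmod z <= 1 /\ comp_app f n (Some z) = Some w)
      <-> Cmod (Csub w c) <= r.

Fixpoint gprod (f : nat -> mob) (n : nat) : R :=
  match n with
  | O => 1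
  | S k => gprod f k * gamma (f (S k))
  end.

(* Main.v *)
(** Let r_n be the radius of F_n(D).  The discs are nested, so the sequence is
    of limit-disc type iff the decreasing sequence r_n stays away from 0.

    If alpha_g <> beta_h then gh maps the closed disc into rho D for some
    rho < 1, uniformly over the finitely many pairs (g, h).  A disc automorphism
    sends rho D to a Euclidean disc of radius at most rho, so each mismatch
    alpha_{f_(n-1)} <> beta_{f_n} gives r_n <= rho r_(n-2), and infinitely many
    of them force r_n -> 0.

    If f is tangent at b = beta_f, then f(D) is the disc of radius s < 1 tangent
    at b and 1/rad(Mf) = 1/rad(M) + (1/s - 1)/|M'(b)|.  When all
    alpha_{f_(n-1)} = beta_{f_n} from some point on, the chain rule makes
    1/|F_n'(beta_{f_(n+1)})| a constant multiple of gamma_1 ... gamma_n, so 1/r_n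
    has increments comparable to the terms of the series in (ii). *)
From Stdlib Require Import Reals Lra Lia List Classical ClassicalEpsilon Field.
From Coquelicot Require Complex.
Require Import Defs.
Open Scope R_scope.

(** * The field of complex numbers and its modulus *)

Definition C1 : C := (1, 0).
Definition Cconj (z : C) : C := (fst z, - snd z).
Definition Cscal (t : R) (z : C) : C := (t * fst z, t * snd z).
Definition nsq (z : C) : R := fst z * fst z + snd z * snd z.

Lemma C_eq (z w : C) : fst z = fst w -> snd z = snd w -> z = w.
Proof. destruct z, w; simpl; congruence. Qed.

Lemma nsq_ge0 z : 0 <= nsq z.
Proof. unfold nsq; nra. Qed.

Lemma nsq_C0 : nsq C0 = 0.
Proof. unfold nsq, C0; simpl; ring. Qed.

Lemma nsq_eq0 z : nsq z = 0 -> z = C0.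
Proof. unfold nsq; intro H; apply C_eq; simpl; nra. Qed.

Lemma nsq_gt0 z : z <> C0 -> 0 < nsq z.
Proof.
  intro H; destruct (nsq_ge0 z) as [|E]; trivial.
  now elim H; apply nsq_eq0.
Qed.

Lemma nsq_mul z w : nsq (Cmul z w) = nsq z * nsq w.
Proof. unfold nsq, Cmul; simpl; ring. Qed.

Lemma C_field_theory : field_theory C0 C1 Cadd Cmul Csub Copp Cdiv Cinv eq.
Proof.
  constructor; [constructor| | |]; intros;
    try (apply C_eq; unfold Csub, Cadd, Cmul, Copp, C0, C1; simpl; ring).
  - intro H; injection H; lra.
  - assert (H0 := nsq_gt0 p H); unfold nsq in H0.
    apply C_eq; unfold Cmul, Cinv, C1; simpl; field; lra.
Qed.
Add Field Cfield : C_field_theory.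

Lemma Cmul_neq0 z w : z <> C0 -> w <> C0 -> Cmul z w <> C0.
Proof.
  intros Hz Hw H. apply nsq_gt0 in Hz, Hw.
  assert (E := nsq_mul z w). rewrite H, nsq_C0 in E. nra.
Qed.

Lemma Csub_eq0 z w : Csub z w = C0 -> z = w.
Proof.
  intro H. replace z with (Cadd (Csub z w) w) by ring. rewrite H; ring.
Qed.

Lemma Cmod_sqr z : Cmod z * Cmod z = nsq z.
Proof. apply sqrt_sqrt, nsq_ge0. Qed.

Lemma Cmod_C0 : Cmod C0 = 0.
Proof. unfold Cmod; fold (nsq C0); rewrite nsq_C0; apply sqrt_0. Qed.

Lemma Cmod_ge0 z : 0 <= Cmod z.
Proof. apply sqrt_pos. Qed.

Lemma Cmod_gt0 z : z <> C0 -> 0 < Cmod z.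
Proof. intro H; apply sqrt_lt_R0, nsq_gt0, H. Qed.

Lemma Cmod_le z t : 0 <= t -> Cmod z <= t <-> nsq z <= t * t.
Proof. rewrite <- Cmod_sqr; generalize (Cmod_ge0 z); nra. Qed.

Lemma Cmod_lt z t : 0 <= t -> Cmod z < t <-> nsq z < t * t.
Proof. rewrite <- Cmod_sqr; generalize (Cmod_ge0 z); nra. Qed.

Lemma Cmod_eq z t : 0 <= t -> Cmod z = t <-> nsq z = t * t.
Proof. rewrite <- Cmod_sqr; generalize (Cmod_ge0 z); nra. Qed.

Lemma Cmod_mul z w : Cmod (Cmul z w) = Cmod z * Cmod w.
Proof.
  apply Cmod_eq; [apply Rmult_le_pos; apply Cmod_ge0|].
  rewrite nsq_mul, <- !Cmod_sqr; ring.
Qed.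

Lemma Cmod_Coquelicot z : Cmod z = Complex.Cmod z.
Proof. unfold Cmod, Complex.Cmod; f_equal; ring. Qed.

Lemma Cmod_add z w : Cmod (Cadd z w) <= Cmod z + Cmod w.
Proof. rewrite !Cmod_Coquelicot; apply (Complex.Cmod_triangle z w). Qed.

Lemma Cmod_scal t z : 0 <= t -> Cmod (Cscal t z) = t * Cmod z.
Proof.
  intro Ht; apply Cmod_eq; [generalize (Cmod_ge0 z); nra|].
  replace (t * Cmod z * (t * Cmod z)) with (t * t * (Cmod z * Cmod z)) by ring.
  rewrite Cmod_sqr; unfold nsq, Cscal; simpl; ring.
Qed.

Lemma Cmod_subC z w : Cmod (Csub z w) = Cmod (Csub w z).
Proof. unfold Cmod; f_equal; unfold Csub, Cadd, Copp; simpl; ring. Qed.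

Lemma Cmod_sub_triangle u v w : Cmod (Csub u w) <= Cmod (Csub u v) + Cmod (Csub v w).
Proof. replace (Csub u w) with (Cadd (Csub u v) (Csub v w)) by ring; apply Cmod_add. Qed.

Lemma coord_le z : Rabs (fst z) <= Cmod z /\ Rabs (snd z) <= Cmod z.
Proof.
  split; (rewrite <- (Rabs_right (Cmod z)) by (apply Rle_ge, Cmod_ge0)); apply Rsqr_le_abs_0;
    unfold Rsqr; rewrite Cmod_sqr; unfold nsq; nra.
Qed.

Lemma Cmod_le_coord z : Cmod z <= Rabs (fst z) + Rabs (snd z).
Proof.
  assert (H1 := Rabs_pos (fst z)). assert (H2 := Rabs_pos (snd z)).
  apply Cmod_le; [lra|]. unfold nsq.
  assert (E1 : fst z * fst z = Rabs (fst z) * Rabs (fst z)) by apply Rsqr_abs.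
  assert (E2 : snd z * snd z = Rabs (snd z) * Rabs (snd z)) by apply Rsqr_abs.
  nra.
Qed.

(** * Farthest points and inclusion of Euclidean discs *)

Lemma disc_far_point c r c' : 0 <= r ->
  exists w, Cmod (Csub w c) <= r /\ Cmod (Csub w c') = Cmod (Csub c c') + r.
Proof.
  intro Hr. destruct (Ceq_dec c c') as [E|E].
  - subst c'. exists (Cadd c (r, 0)).
    replace (Csub (Cadd c (r, 0)) c) with ((r, 0) : C)
      by (apply C_eq; unfold Csub, Cadd, Copp; simpl; ring).
    replace (Csub c c) with C0 by ring.
    assert (H : Cmod (r, 0) = r) by (apply Cmod_eq; trivial; unfold nsq; simpl; ring).
    rewrite H, Cmod_C0; lra.
  - assert (Hd : 0 < Cmod (Csub c c')).
    { apply Cmod_gt0; intro H; apply E, Csub_eq0, H. }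
    (* The farthest point lies on the ray from [c'] through [c]; the factor [t] scales [Csub c c']
       to length [r]. *)
    set (t := r / Cmod (Csub c c')).
    assert (Ht : 0 <= t) by (apply Rmult_le_pos; trivial; left; apply Rinv_0_lt_compat, Hd).
    assert (Et : t * Cmod (Csub c c') = r) by (unfold t; field; lra).
    exists (Cadd c (Cscal t (Csub c c'))). split.
    + replace (Csub _ c) with (Cscal t (Csub c c'))
        by (apply C_eq; unfold Csub, Cadd, Copp, Cscal; simpl; ring).
      rewrite Cmod_scal; lra.
    + replace (Csub _ c') with (Cscal (1 + t) (Csub c c')).
      * rewrite Cmod_scal; lra.
      * apply C_eq; unfold Csub, Cadd, Copp, Cscal; simpl; ring.
Qed.

(** Test the inclusion at the point of the inner disc farthest from [c']. *)
Lemma disc_sub_disc c r c' r' : 0 <= r ->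
  (forall w, Cmod (Csub w c) <= r -> Cmod (Csub w c') <= r') ->
  Cmod (Csub c c') <= r' - r.
Proof.
  intros Hr H. destruct (disc_far_point c r c' Hr) as [w [H1 H2]].
  specialize (H w H1); lra.
Qed.

(** * Möbius maps as matrices, and the image of the closed unit disc *)

Definition num (M : mob) (z : C) : C := Cadd (Cmul (ma M) z) (mb M).
Definition den (M : mob) (z : C) : C := Cadd (Cmul (mc M) z) (md M).
Definition app (M : mob) (z : C) : C := Cdiv (num M z) (den M z).

Definition mob_id : mob := Mob C1 C0 C0 C1.
Definition mob_mul (M N : mob) : mob :=
  Mob (Cadd (Cmul (ma M) (ma N)) (Cmul (mb M) (mc N)))
      (Cadd (Cmul (ma M) (mb N)) (Cmul (mb M) (md N)))
      (Cadd (Cmul (mc M) (ma N)) (Cmul (md M) (mc N)))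
      (Cadd (Cmul (mc M) (mb N)) (Cmul (md M) (md N))).

(** Maps of the closed disc into itself, written without a quotient. Unlike [in_MD] this admits the
    identity; being stable under products, it covers all partial compositions. *)
Definition good (M : mob) : Prop :=
  mob_det M <> C0 /\ forall z, Cmod z <= 1 -> Cmod (num M z) <= Cmod (den M z).

(** Positivity of [lam] puts the pole -d/c outside the closed disc; [ctr] and [rad] are then the
    centre and radius of the image of the unit disc. *)
Definition lam (M : mob) : R := nsq (md M) - nsq (mc M).
Definition ctr (M : mob) : C :=
  Cscal (/ lam M) (Csub (Cmul (mb M) (Cconj (md M))) (Cmul (ma M) (Cconj (mc M)))).
Definition rad (M : mob) : R := Cmod (mob_det M) / lam M.

Lemma mob_app_den M z : den M z <> C0 -> mob_app M (Some z) = Some (app M z).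
Proof.
  intro H; unfold mob_app. fold (den M z). destruct (Ceq_dec _ _); [contradiction|reflexivity].
Qed.

Lemma mob_app_Some M z w : mob_app M (Some z) = Some w -> den M z <> C0 /\ app M z = w.
Proof.
  unfold mob_app; fold (den M z); destruct (Ceq_dec _ _); [discriminate|].
  intro H; injection H; auto.
Qed.

Lemma mob_det_mul M N : mob_det (mob_mul M N) = Cmul (mob_det M) (mob_det N).
Proof. unfold mob_det, mob_mul; simpl; ring. Qed.

Lemma num_mul M N z : den N z <> C0 ->
  num (mob_mul M N) z = Cmul (num M (app N z)) (den N z).
Proof. intro H; unfold app, num, mob_mul in *; simpl; unfold den in *; field; exact H. Qed.

Lemma den_mul M N z : den N z <> C0 ->
  den (mob_mul M N) z = Cmul (den M (app N z)) (den N z).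
Proof. intro H; unfold app, num, mob_mul in *; unfold den in *; simpl; field; exact H. Qed.

Lemma app_mul M N z : den N z <> C0 -> den M (app N z) <> C0 ->
  app (mob_mul M N) z = app M (app N z).
Proof.
  intros H H'. unfold app at 1. rewrite num_mul, den_mul by trivial.
  unfold app at 3. field; auto.
Qed.

(** If the denominator vanishes, the inequality in [good] makes the numerator vanish too; the
    determinant is a combination of the two, hence 0. *)
Lemma good_den M z : good M -> Cmod z <= 1 -> den M z <> C0.
Proof.
  intros [Hd H] Hz E. specialize (H z Hz).
  assert (N0 : num M z = C0).
  { apply nsq_eq0. rewrite <- Cmod_sqr. rewrite E, Cmod_C0 in H.
    generalize (Cmod_ge0 (num M z)); nra. }
  apply Hd. replace (mob_det M) with (Csub (Cmul (ma M) (den M z)) (Cmul (mc M) (num M z)))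
    by (unfold mob_det, den, num; ring).
  rewrite E, N0; ring.
Qed.

Lemma Cmod_div z w : w <> C0 -> Cmod (Cdiv z w) = Cmod z / Cmod w.
Proof.
  intro H. assert (Hw := Cmod_gt0 w H).
  apply Rmult_eq_reg_r with (Cmod w); [|lra].
  rewrite <- Cmod_mul. replace (Cmul (Cdiv z w) w) with z by (field; exact H).
  field; lra.
Qed.

Lemma good_app M z : good M -> Cmod z <= 1 -> Cmod (app M z) <= 1.
Proof.
  intros HM Hz. assert (Hd := good_den M z HM Hz).
  unfold app. rewrite Cmod_div by trivial. apply Cmod_gt0 in Hd.
  apply Rmult_le_reg_r with (Cmod (den M z)); trivial.
  unfold Rdiv. rewrite Rmult_assoc, Rinv_l, Rmult_1_l, Rmult_1_r by lra. apply HM, Hz.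
Qed.

Lemma good_mul M N : good M -> good N -> good (mob_mul M N).
Proof.
  intros HM HN. split.
  - rewrite mob_det_mul. apply Cmul_neq0; [apply HM|apply HN].
  - intros z Hz. assert (Hd := good_den N z HN Hz).
    rewrite num_mul, den_mul, !Cmod_mul by trivial.
    apply Rmult_le_compat_r; [apply Cmod_ge0|]. apply HM, good_app; trivial.
Qed.

Lemma good_id : good mob_id.
Proof.
  split.
  - unfold mob_det, mob_id, Csub, Cadd, Cmul, Copp, C0, C1; simpl. intro H; injection H; lra.
  - intros z Hz. replace (num mob_id z) with z by (unfold num, mob_id; simpl; ring).
    replace (den mob_id z) with C1 by (unfold den, mob_id; simpl; ring).
    replace (Cmod C1) with 1; trivial.
    symmetry; apply Cmod_eq; [lra|unfold nsq, C1; simpl; ring].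
Qed.

(** Otherwise the pole -d/c would lie in the closed disc, against [good_den]. *)
Lemma good_lam M : good M -> 0 < lam M.
Proof.
  intro HM. apply Rnot_le_lt; intro Hl. unfold lam in Hl.
  assert (Hc : mc M <> C0).
  { intro E. apply (proj1 HM). unfold mob_det.
    rewrite (nsq_eq0 (md M)), E; [ring|].
    rewrite E, nsq_C0 in Hl. generalize (nsq_ge0 (md M)); lra. }
  apply (good_den M (Copp (Cdiv (md M) (mc M))) HM).
  - apply Cmod_le; [lra|].
    replace (nsq (Copp _)) with (nsq (Cdiv (md M) (mc M))) by (unfold nsq, Copp; simpl; ring).
    assert (E : nsq (md M) = nsq (Cdiv (md M) (mc M)) * nsq (mc M)).
    { rewrite <- nsq_mul. f_equal; field; trivial. }
    assert (H := nsq_gt0 _ Hc). generalize (nsq_ge0 (Cdiv (md M) (mc M))); nra.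
  - unfold den; field; trivial.
Qed.

Lemma good_rad M : good M -> 0 < rad M.
Proof.
  intro HM. apply Rdiv_lt_0_compat; [apply Cmod_gt0, HM|apply good_lam, HM].
Qed.

(** Solving w = M(z) gives z = (dw - b)/(a - cw), so the right-hand side has the sign of |z|^2 -
    1. *)
Lemma disc_equation M w : lam M <> 0 ->
  lam M * (nsq (Csub w (ctr M)) - rad M * rad M)
  = nsq (Csub (Cmul (md M) w) (mb M)) - nsq (Csub (ma M) (Cmul (mc M) w)).
Proof.
  intro Hl. unfold rad.
  replace (Cmod (mob_det M) / lam M * (Cmod (mob_det M) / lam M))
    with (Cmod (mob_det M) * Cmod (mob_det M) / (lam M * lam M)) by (field; trivial).
  rewrite Cmod_sqr. unfold ctr.
  destruct M as [[a a'] [b b'] [c c'] [d d']]; destruct w as [x y].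
  unfold lam, mob_det, nsq, Csub, Cadd, Copp, Cmul, Cconj, Cscal in *; simpl in *.
  field; trivial.
Qed.

Lemma disc_equation_app M z : lam M <> 0 -> den M z <> C0 ->
  lam M * (nsq (Csub (app M z) (ctr M)) - rad M * rad M) * nsq (den M z)
  = nsq (mob_det M) * (nsq z - 1).
Proof.
  intros Hl Hd. rewrite disc_equation, Rmult_minus_distr_r, <- !nsq_mul by trivial.
  rewrite Rmult_minus_distr_l, Rmult_1_r, <- nsq_mul.
  f_equal; [f_equal|do 2 f_equal]; unfold app, num, mob_det; unfold den in *; field; trivial.
Qed.

Lemma image_disc M w : good M ->
  (exists z, Cmod z <= 1 /\ app M z = w) <-> Cmod (Csub w (ctr M)) <= rad M.
Proof.
  intro HM. assert (Hl := good_lam M HM). assert (Hr := good_rad M HM).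
  rewrite Cmod_le by lra. split.
  - intros [z [Hz Ew]]. assert (Hd := good_den M z HM Hz). apply nsq_gt0 in Hd as Hd'.
    assert (E := disc_equation_app M z ltac:(lra) Hd). rewrite Ew in E.
    apply Cmod_le in Hz; [|lra]. assert (H := nsq_ge0 (mob_det M)).
    apply Rnot_lt_le; intro Hlt.
    assert (0 < lam M * (nsq (Csub w (ctr M)) - rad M * rad M) * nsq (den M z))
      by (repeat apply Rmult_lt_0_compat; lra).
    nra.
  - intro Hw. assert (E := disc_equation M w ltac:(lra)).
    set (p := Csub (Cmul (md M) w) (mb M)) in *.
    set (q := Csub (ma M) (Cmul (mc M) w)) in *.
    assert (Hpq : nsq p <= nsq q) by nra.
    (* The determinant combines [p] and [q], so they cannot both vanish; [Hpq] then leaves [q]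
       nonzero, and [Cdiv p q] is the preimage of [w]. *)
    assert (Edet : mob_det M = Csub (Cmul (md M) q) (Cmul (Copp (mc M)) p))
      by (unfold mob_det, p, q; ring).
    assert (Hq : q <> C0).
    { intro Eq. apply (proj1 HM). rewrite Edet, Eq, (nsq_eq0 p); [ring|].
      rewrite Eq, nsq_C0 in Hpq.
      generalize (nsq_ge0 p); lra. }
    exists (Cdiv p q). assert (Hq' := nsq_gt0 _ Hq).
    assert (Hz : Cmod (Cdiv p q) <= 1).
    { apply Cmod_le; [lra|]. assert (Ep : nsq p = nsq (Cdiv p q) * nsq q).
      { rewrite <- nsq_mul; f_equal; field; trivial. }
      generalize (nsq_ge0 (Cdiv p q)); nra. }
    split; trivial. assert (Hd := good_den M _ HM Hz).
    replace (app M (Cdiv p q)) with (Cdiv (Cmul (mob_det M) w) (mob_det M)).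
    + field; apply HM.
    + assert (En : num M (Cdiv p q) = Cdiv (Cmul (mob_det M) w) q)
        by (unfold num, mob_det, p, q in *; field; trivial).
      assert (Ed : den M (Cdiv p q) = Cdiv (mob_det M) q)
        by (unfold den, mob_det, p, q in *; field; trivial).
      unfold app; rewrite En, Ed. field; split; trivial; apply HM.
Qed.

Lemma good_ctr_rad M : good M -> Cmod (ctr M) + rad M <= 1.
Proof.
  intro HM. assert (Hr := good_rad M HM).
  assert (H := disc_sub_disc (ctr M) (rad M) C0 1 ltac:(lra)).
  replace (Csub (ctr M) C0) with (ctr M) in H by ring.
  cut (Cmod (ctr M) <= 1 - rad M); [lra|]. apply H. intros w Hw.
  replace (Csub w C0) with w by ring.
  apply image_disc in Hw; trivial. destruct Hw as [z [Hz <-]]. apply good_app; trivial.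
Qed.

(** * Radius of the image under a composition *)

Lemma lam_mul M N : lam N <> 0 ->
  lam (mob_mul M N)
  = lam N * (nsq (den M (ctr N)) - rad N * rad N * nsq (mc M)).
Proof.
  intro Hl. unfold rad.
  replace (Cmod (mob_det N) / lam N * (Cmod (mob_det N) / lam N))
    with (Cmod (mob_det N) * Cmod (mob_det N) / (lam N * lam N)) by (field; trivial).
  rewrite Cmod_sqr. unfold ctr.
  destruct M as [[a a'] [b b'] [c c'] [d d']]; destruct N as [[s s'] [t t'] [u u'] [v v']].
  unfold den, lam, mob_mul, mob_det, nsq, Csub, Cadd, Copp, Cmul, Cconj, Cscal in *; simpl in *.
  field; trivial.
Qed.

(** For c nonzero the numerator is |c|^2 times the power of the pole of [M] with respect to the
    circle bounding N(D); this form also covers c = 0. The contraction estimate and the tangency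
    formula both come from here. *)
Lemma rad_mul_inv M N : good M -> good N ->
  / rad (mob_mul M N)
  = (nsq (den M (ctr N)) - rad N * rad N * nsq (mc M)) / (rad N * Cmod (mob_det M)).
Proof.
  intros HM HN. assert (HMN := good_mul M N HM HN).
  assert (Hl := good_lam N HN). assert (Hl' := good_lam _ HMN).
  assert (E := lam_mul M N ltac:(lra)).
  assert (H1 := Cmod_gt0 _ (proj1 HM)). assert (H2 := Cmod_gt0 _ (proj1 HN)).
  set (X := nsq _ - _) in *. unfold rad. rewrite mob_det_mul, Cmod_mul, E.
  field. repeat split; try lra. intro H0; rewrite H0 in E; lra.
Qed.

(* [Cmod (ctr N) + rad N] is the least rho with N(D) contained in rho D. *)
Lemma rad_mul_le M N : good M -> good N ->
  rad (mob_mul M N) <= (Cmod (ctr N) + rad N) * rad M.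
Proof.
  intros HM HN. assert (HMN := good_mul M N HM HN).
  assert (Hr := good_rad N HN). assert (HrM := good_rad M HM). assert (Hr' := good_rad _ HMN).
  assert (Hl := good_lam M HM). assert (H1 := Cmod_gt0 _ (proj1 HM)).
  assert (Hc := good_ctr_rad N HN). assert (Hk := Cmod_ge0 (ctr N)).
  set (k := Cmod (ctr N)) in *. set (r := rad N) in *.
  set (x := Cmod (mc M)). set (y := Cmod (md M)).
  assert (Hx : 0 <= x) by apply Cmod_ge0. assert (Hy : 0 <= y) by apply Cmod_ge0.
  assert (El : lam M = y * y - x * x) by (unfold lam, x, y; rewrite !Cmod_sqr; trivial).
  assert (Hxy : x < y) by nra.
  assert (Hden : y - k * x <= Cmod (den M (ctr N))).
  { assert (T := Cmod_add (den M (ctr N)) (Copp (Cmul (mc M) (ctr N)))).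
    replace (Cadd _ _) with (md M) in T by (unfold den; ring).
    replace (Copp (Cmul (mc M) (ctr N))) with (Cmul (Copp (mc M)) (ctr N)) in T by ring.
    rewrite Cmod_mul in T.
    replace (Cmod (Copp (mc M))) with x in T by (unfold x, Cmod, Copp; f_equal; simpl; ring).
    fold k y in T. lra. }
  assert (E := rad_mul_inv M N HM HN). fold r in E.
  set (X := nsq (den M (ctr N)) - r * r * nsq (mc M)) in *.
  (* With D = |det M| the radii are r D / X for the product and D / lam M for [M], so this is the
     claim with denominators cleared. *)
  assert (HX : r * lam M <= (k + r) * X).
  { assert (HX1 : (y - k * x) * (y - k * x) - r * r * (x * x) <= X).
    { unfold X. rewrite <- !Cmod_sqr. fold x.
      assert (0 <= y - k * x) by nra. nra. }
    apply Rle_trans with ((k + r) * ((y - k * x) * (y - k * x) - r * r * (x * x)));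
      [|apply Rmult_le_compat_l; lra].
    rewrite El.
    (* With k + r fixed, the inequality is affine in r, so it is a combination of
       its two cases r = 0 and k = 0. *)
    apply Rminus_le.
    replace (_ - _) with (- (k * ((y - (k + r) * x) * (y - (k + r) * x))
       + r * ((1 - (k + r) * (k + r)) * (x * x)))) by ring.
    assert (0 <= k * ((y - (k + r) * x) * (y - (k + r) * x))) by (apply Rmult_le_pos; [exact Hk|apply Rle_0_sqr]).
    assert (0 <= r * ((1 - (k + r) * (k + r)) * (x * x)))
      by (apply Rmult_le_pos; [lra|apply Rmult_le_pos; [nra|apply Rle_0_sqr]]).
    lra. }
  assert (HX0 : 0 < X) by nra.
  replace (rad (mob_mul M N)) with (r * Cmod (mob_det M) / X).
  - unfold rad. apply Rmult_le_reg_r with (X * lam M); [nra|].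
    replace (r * Cmod (mob_det M) / X * (X * lam M)) with (r * lam M * Cmod (mob_det M))
      by (field; lra).
    replace ((k + r) * (Cmod (mob_det M) / lam M) * (X * lam M))
      with ((k + r) * X * Cmod (mob_det M)) by (field; lra).
    apply Rmult_le_compat_r; lra.
  - rewrite <- (Rinv_inv (rad (mob_mul M N))), E. field; lra.
Qed.

Lemma rad_mul_le_rad M N : good M -> good N -> rad (mob_mul M N) <= rad M.
Proof.
  intros HM HN. assert (H := rad_mul_le M N HM HN).
  assert (H' := good_ctr_rad N HN). assert (Hr := good_rad M HM). nra.
Qed.

(** * Self-maps of the open disc, extended to the closed disc *)

Lemma quadratic_ge0_at_1 p q s :
  (forall t, 0 <= t < 1 -> 0 <= p * (t * t) + q * t + s) -> 0 <= p + q + s.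
Proof.
  intro H. apply Rnot_lt_le; intro Hneg.
  (* At 1 - e the polynomial is at most -d + e (2|p| + |q|). The choice e = d / k keeps this
     negative and e at most 1. *)
  set (d := - (p + q + s)). set (k := 2 * Rabs p + Rabs q + 2 * d).
  assert (Hp := Rabs_pos p). assert (Hq := Rabs_pos q).
  assert (Hd : 0 < d) by (unfold d; lra). assert (Hk : 0 < k) by (unfold k; lra).
  set (e := d / k). assert (Ee : e * k = d) by (unfold e; field; lra).
  assert (He : 0 < e) by (apply Rdiv_lt_0_compat; lra).
  assert (He1 : e <= 1) by (unfold k in Ee; nra).
  specialize (H (1 - e) ltac:(lra)).
  assert (- p <= Rabs p) by (rewrite <- Rabs_Ropp; apply Rle_abs).
  assert (p <= Rabs p) by apply Rle_abs.
  assert (- q <= Rabs q) by (rewrite <- Rabs_Ropp; apply Rle_abs).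
  replace (p * ((1 - e) * (1 - e)) + q * (1 - e) + s) with (- d + e * (- p * (2 - e) - q)) in H
    by (unfold d; ring).
  assert (- p * (2 - e) - q <= 2 * Rabs p + Rabs q) by nra.
  unfold k in Ee. nra.
Qed.

Lemma in_MD_lt f z : in_MD f -> Cmod z < 1 -> den f z <> C0 /\ Cmod (app f z) < 1.
Proof.
  intros [_ [H _]] Hz. destruct (H z Hz) as [w [E Hw]].
  apply mob_app_Some in E. destruct E as [E <-]; auto.
Qed.

(** On the segment from 0 to z, |den|^2 - |num|^2 is a quadratic polynomial in t, nonnegative for t
    < 1; [quadratic_ge0_at_1] passes to t = 1. *)
Lemma in_MD_good f : in_MD f -> good f.
Proof.
  intro Hf; split; [apply Hf|]. intros z Hz.
  apply Cmod_le; [apply Cmod_ge0|]. rewrite Cmod_sqr.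
  set (az := Cmul (ma f) z). set (cz := Cmul (mc f) z).
  assert (H := quadratic_ge0_at_1 (nsq cz - nsq az)
    (2 * (fst cz * fst (md f) + snd cz * snd (md f))
     - 2 * (fst az * fst (mb f) + snd az * snd (mb f)))
    (nsq (md f) - nsq (mb f))).
  cut (0 <= nsq (den f z) - nsq (num f z)); [lra|].
  replace (nsq (den f z) - nsq (num f z)) with (nsq cz - nsq az
    + (2 * (fst cz * fst (md f) + snd cz * snd (md f))
     - 2 * (fst az * fst (mb f) + snd az * snd (mb f)))
    + (nsq (md f) - nsq (mb f)))
    by (unfold num, den; fold az cz; unfold nsq, Cadd; simpl; ring).
  apply H. intros t Ht.
  assert (Htz : Cmod (Cscal t z) < 1).
  { rewrite Cmod_scal by lra. generalize (Cmod_ge0 z); nra. }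
  destruct (in_MD_lt f _ Hf Htz) as [Hd Hw].
  unfold app in Hw. rewrite Cmod_div in Hw by trivial.
  apply Cmod_gt0 in Hd as Hd'.
  assert (Hle : Cmod (num f (Cscal t z)) <= Cmod (den f (Cscal t z))).
  { apply Rmult_lt_compat_r with (r := Cmod (den f (Cscal t z))) in Hw; trivial.
    unfold Rdiv in Hw. rewrite Rmult_assoc, Rinv_l in Hw by lra. lra. }
  apply Cmod_le in Hle; [|apply Cmod_ge0]. rewrite Cmod_sqr in Hle.
  replace (_ + _) with (nsq (den f (Cscal t z)) - nsq (num f (Cscal t z))); [lra|].
  unfold num, den, az, cz, nsq, Cadd, Cmul, Cscal; simpl; ring.
Qed.

(** A radius of at least 1 would make the image the whole closed unit disc. The point of D omitted
    by f(D) would then have a preimage in the closed disc, and the disc equation puts that preimage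
    in the open disc. *)
Lemma in_MD_rad_lt1 f : in_MD f -> rad f < 1.
Proof.
  intro Hf. assert (Hg := in_MD_good f Hf). assert (Hs := good_ctr_rad f Hg).
  apply Rnot_le_lt; intro H1. assert (Hk := Cmod_ge0 (ctr f)).
  assert (Hc : ctr f = C0) by (apply nsq_eq0; rewrite <- Cmod_sqr; nra).
  assert (Hr : rad f = 1) by lra.
  destruct Hf as [_ [Hf [w [Hw Hno]]]].
  assert (Ew : forall v, Csub v C0 = v) by (intro; ring).
  destruct (proj2 (image_disc f w Hg)) as [z [Hz E]].
  { rewrite Hc, Hr, Ew; lra. }
  assert (Hd := good_den f z Hg Hz). assert (Hl := good_lam f Hg).
  apply Hno. exists z. split; [|rewrite mob_app_den, E; trivial].
  assert (I := disc_equation_app f z ltac:(lra) Hd).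
  rewrite E, Hc, Hr, Ew in I.
  apply Cmod_lt in Hw; [|lra]. apply Cmod_lt; [lra|].
  apply nsq_gt0 in Hd. assert (H := nsq_gt0 _ (proj1 Hg)).
  assert (0 < lam f * (1 * 1 - nsq w) * nsq (den f z))
    by (repeat apply Rmult_lt_0_compat; lra).
  nra.
Qed.

(** * Tangency points *)

Lemma app_inj M z w : mob_det M <> C0 -> den M z <> C0 -> den M w <> C0 ->
  app M z = app M w -> z = w.
Proof.
  intros HD Hz Hw E. apply Csub_eq0. unfold app in E.
  apply NNPP; intro H. apply (Cmul_neq0 _ _ HD H).
  assert (E1 : Cmul (num M z) (den M w) = Cmul (num M w) (den M z)).
  { replace (num M z) with (Cmul (Cdiv (num M z) (den M z)) (den M z)) by (field; trivial).
    rewrite E. field; trivial. }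
  replace (Cmul (mob_det M) (Csub z w))
    with (Csub (Cmul (num M z) (den M w)) (Cmul (num M w) (den M z)))
    by (unfold num, den, mob_det; ring).
  rewrite E1; ring.
Qed.

(** The point [b] of modulus 1 is at distance [rad f] from the centre, and the centre at distance at
    most [1 - rad f] from 0. Equality in the triangle inequality puts the centre on the segment from
    0 to [b]. *)
Lemma tangent_ctr f a b : in_MD f -> Cmod a = 1 -> Cmod b = 1 ->
  mob_app f (Some a) = Some b -> ctr f = Cscal (1 - rad f) b.
Proof.
  intros Hf Ha Hb E. apply mob_app_Some in E. destruct E as [Hd E].
  assert (Hg := in_MD_good f Hf). assert (Hs := good_ctr_rad f Hg).
  assert (Hr := good_rad f Hg). assert (Hl := good_lam f Hg).
  assert (I := disc_equation_app f a ltac:(lra) Hd).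
  apply Cmod_eq in Ha; [|lra]. apply Cmod_eq in Hb; [|lra].
  rewrite E, Ha in I.
  replace (nsq (mob_det f) * (1 * 1 - 1)) with 0 in I by ring.
  apply nsq_gt0 in Hd.
  assert (I' : nsq (Csub b (ctr f)) = rad f * rad f).
  { apply Rmult_integral in I. destruct I as [I|I]; [|lra].
    apply Rmult_integral in I. destruct I as [I|I]; lra. }
  assert (Hc : Cmod (ctr f) <= 1 - rad f) by lra.
  assert (H1r : 0 <= 1 - rad f) by (generalize (Cmod_ge0 (ctr f)); lra).
  apply Cmod_le in Hc; trivial.
  apply Csub_eq0, nsq_eq0. apply Rle_antisym; [|apply nsq_ge0].
  (* Stewart's identity; with r = [rad f] the bounds make it at most r(1-r)^2 + (1-r)r^2 - r(1-r) =
     0. *)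
  replace (nsq (Csub (ctr f) (Cscal (1 - rad f) b)))
    with (rad f * nsq (ctr f) + (1 - rad f) * (nsq (Csub b (ctr f)))
          + ((1 - rad f) * (1 - rad f) - (1 - rad f)) * nsq b)
    by (unfold nsq, Csub, Cadd, Copp, Cscal; simpl; ring).
  rewrite I', Hb. nra.
Qed.

Lemma alpha_beta_spec f : tangent f -> ab_spec f (alpha_beta f).
Proof.
  intro H. unfold alpha_beta. destruct (excluded_middle_informative _) as [_|N]; [|contradiction].
  apply epsilon_spec. destruct H as [a [b H]]. exists (a, Some b). exact H.
Qed.

(** The choice made by [epsilon] is determined: the centre is [1 - rad f] times [b] with [rad f]
    below 1, which fixes [b], and injectivity fixes [a]. *)
Lemma alpha_beta_unique f a b : in_MD f -> Cmod a = 1 -> Cmod b = 1 ->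
  mob_app f (Some a) = Some b -> alpha f = a /\ beta f = Some b.
Proof.
  intros Hf Ha Hb E.
  assert (H := alpha_beta_spec f ltac:(exists a, b; auto)).
  unfold alpha, beta. destruct (alpha_beta f) as [a' [b'|]]; [|contradiction].
  destruct H as [Ha' [Hb' E']]. simpl.
  assert (Hr := in_MD_rad_lt1 f Hf).
  assert (T := tangent_ctr f a b Hf Ha Hb E).
  assert (T' := tangent_ctr f a' b' Hf Ha' Hb' E').
  assert (b' = b).
  { rewrite T in T'. injection T'. intros H1 H2.
    apply C_eq; apply Rmult_eq_reg_l with (1 - rad f); lra. }
  subst b'. split; trivial.
  apply mob_app_Some in E, E'. destruct E as [D E], E' as [D' E'].
  apply (app_inj f); trivial; [apply Hf|congruence].
Qed.

Lemma beta_Some f b : beta f = Some b ->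
  Cmod (alpha f) = 1 /\ Cmod b = 1 /\ mob_app f (Some (alpha f)) = Some b.
Proof.
  unfold alpha, beta, alpha_beta.
  destruct (excluded_middle_informative (tangent f)) as [T|]; [|discriminate].
  assert (H := alpha_beta_spec f T). unfold alpha_beta in H.
  destruct (excluded_middle_informative (tangent f)) as [_|]; [|contradiction].
  destruct (epsilon _ _) as [a [b'|]]; simpl in *; [|discriminate].
  intro E; injection E; intros ->; exact H.
Qed.

Lemma Cmod_alpha_le1 f : Cmod (alpha f) <= 1.
Proof.
  unfold alpha, alpha_beta.
  destruct (excluded_middle_informative (tangent f)) as [T|]; simpl; [|rewrite Cmod_C0; lra].
  assert (H := alpha_beta_spec f T). unfold alpha_beta in H.
  destruct (excluded_middle_informative (tangent f)) as [_|]; [|contradiction].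
  destruct (epsilon _ _) as [a [b'|]]; simpl in *; [|contradiction]. lra.
Qed.

(** If gh sent z to the unit circle, then |h(z)| = 1 and |z| = 1, since both maps send the open disc
    into itself. So h(z) would be both [alpha g] and the point [beta h]. *)
Lemma mismatch_compact_image g h : in_MD g -> in_MD h ->
  Some (alpha g) <> beta h ->
  Cmod (ctr (mob_mul g h)) + rad (mob_mul g h) < 1.
Proof.
  intros Hg Hh Hne.
  assert (Gg := in_MD_good g Hg). assert (Gh := in_MD_good h Hh).
  assert (Ggh := good_mul g h Gg Gh).
  (* The left-hand side is the largest modulus on the image, attained at [w]. *)
  destruct (disc_far_point (ctr (mob_mul g h)) (rad (mob_mul g h)) C0) as [w [Hw Ew]].
  { left; apply good_rad; trivial. }
  replace (Csub w C0) with w in Ew by ring.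
  replace (Csub (ctr (mob_mul g h)) C0) with (ctr (mob_mul g h)) in Ew by ring.
  rewrite <- Ew. apply image_disc in Hw; trivial. destruct Hw as [z [Hz <-]].
  clear Ew. assert (Dz := good_den h z Gh Hz).
  assert (Hu := good_app h z Gh Hz). set (u := app h z) in *.
  assert (Du := good_den g u Gg Hu).
  rewrite app_mul by trivial. fold u.
  apply Rnot_le_lt; intro H1. apply Hne.
  assert (Hv := good_app g u Gg Hu).
  assert (U1 : Cmod u = 1).
  { destruct Hu as [Hu|]; trivial. destruct (in_MD_lt g u Hg Hu); lra. }
  assert (Z1 : Cmod z = 1).
  { destruct Hz as [Hz|]; trivial. destruct (in_MD_lt h z Hh Hz) as [_ K]. fold u in K; lra. }
  destruct (alpha_beta_unique g u (app g u)) as [A _]; trivial; [lra|apply mob_app_den; trivial|].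
  destruct (alpha_beta_unique h z u) as [_ B]; trivial; [apply mob_app_den; trivial|].
  congruence.
Qed.

(** * Derivatives and the factors [gamma] *)

Lemma gamma_eq f : den f (alpha f) <> C0 ->
  gamma f = nsq (den f (alpha f)) / Cmod (mob_det f).
Proof.
  intro H. unfold gamma, mob_deriv. fold (den f (alpha f)).
  rewrite Cmod_div by (apply Cmul_neq0; trivial).
  rewrite Cmod_mul, Cmod_sqr. unfold Rdiv. rewrite Rinv_mult, Rinv_inv. ring.
Qed.

Lemma gamma_gt0 f : good f -> 0 < gamma f.
Proof.
  intro H. assert (D := good_den f _ H (Cmod_alpha_le1 f)).
  rewrite gamma_eq by trivial. apply Rdiv_lt_0_compat; [apply nsq_gt0, D|apply Cmod_gt0, H].
Qed.

(* [inv_deriv M z] is 1/|M'(z)|. *)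
Definition inv_deriv (M : mob) (z : C) : R := nsq (den M z) / Cmod (mob_det M).

Lemma inv_deriv_gt0 M z : good M -> Cmod z <= 1 -> 0 < inv_deriv M z.
Proof.
  intros HM Hz. apply Rdiv_lt_0_compat;
    [apply nsq_gt0, good_den; trivial|apply Cmod_gt0, HM].
Qed.

Lemma inv_deriv_mul M N z : good M -> good N -> den N z <> C0 ->
  inv_deriv (mob_mul M N) z = inv_deriv M (app N z) * inv_deriv N z.
Proof.
  intros HM HN H. assert (H1 := Cmod_gt0 _ (proj1 HM)). assert (H2 := Cmod_gt0 _ (proj1 HN)).
  unfold inv_deriv. rewrite den_mul, mob_det_mul, Cmod_mul, nsq_mul by trivial. field; lra.
Qed.

(** The disc f(D) has radius [rad f] and centre (1 - rad f) b. Put into [rad_mul_inv], these split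
    the numerator into a multiple of |den(b)|^2, a multiple of [lam M], and a term that vanishes
    because |b| = 1. *)
Lemma rad_mul_tangent_inv M f b : good M -> in_MD f -> beta f = Some b ->
  / rad (mob_mul M f) = / rad M + (/ rad f - 1) * inv_deriv M b.
Proof.
  intros HM Hf Hb. apply beta_Some in Hb. destruct Hb as [Ha [Hb E]].
  assert (T := tangent_ctr f _ b Hf Ha Hb E). assert (Hg := in_MD_good f Hf).
  rewrite rad_mul_inv by trivial. rewrite T.
  assert (Hr := good_rad f Hg). assert (Hl := good_lam M HM).
  assert (HD := Cmod_gt0 _ (proj1 HM)). apply Cmod_eq in Hb; [|lra].
  set (r := rad f) in *. unfold rad, inv_deriv. set (D := Cmod (mob_det M)) in *.
  assert (I : nsq (den M (Cscal (1 - r) b)) - r * r * nsq (mc M)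
    = (1 - r) * nsq (den M b) + r * lam M + (1 - r) * r * nsq (mc M) * (1 - nsq b)).
  { unfold den, lam, nsq, Cadd, Cmul, Cscal; simpl; ring. }
  rewrite I, Hb. field. repeat split; lra.
Qed.

(** * Nested image discs of a composition sequence *)

Fixpoint mat (f : nat -> mob) (n : nat) : mob :=
  match n with
  | O => mob_id
  | S k => mob_mul (mat f k) (f (S k))
  end.

Definition disc_ctr (f : nat -> mob) (n : nat) : C := ctr (mat f n).
Definition disc_rad (f : nat -> mob) (n : nat) : R := rad (mat f n).

Section Composition.

Variable f : nat -> mob.
Hypothesis f_good : forall n, good (f (S n)).

Lemma mat_good n : good (mat f n).
Proof. induction n; simpl; [apply good_id|apply good_mul; trivial]. Qed.

Lemma comp_app_mat n z : Cmod z <= 1 -> comp_app f n (Some z) = Some (app (mat f n) z).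
Proof.
  revert z; induction n as [|n IH]; intros z Hz.
  - simpl; f_equal. unfold app, num, den; simpl. field.
    replace (Cadd (Cmul C0 z) C1) with C1 by ring.
    unfold C1, C0; intro H; injection H; lra.
  - assert (D := good_den _ z (f_good n) Hz). assert (Hw := good_app _ z (f_good n) Hz).
    change (comp_app f n (mob_app (f (S n)) (Some z)) = Some (app (mat f (S n)) z)).
    rewrite mob_app_den, IH by trivial. simpl mat. rewrite app_mul; trivial.
    apply good_den; trivial. apply mat_good.
Qed.

Local Notation c := (disc_ctr f).
Local Notation r := (disc_rad f).

Lemma in_image_iff n w :
  (exists z, Cmod z <= 1 /\ comp_app f n (Some z) = Some w) <-> Cmod (Csub w (c n)) <= r n.
Proof.
  unfold disc_ctr, disc_rad. rewrite <- (image_disc _ _ (mat_good n)).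
  split; intros [z [Hz E]]; exists z; split; trivial; rewrite comp_app_mat in * by trivial.
  - now injection E.
  - now f_equal.
Qed.

Lemma rad_mat_decr m n : (m <= n)%nat -> r n <= r m.
Proof.
  induction 1 as [|n _ IH]; [lra|]. apply Rle_trans with (2 := IH).
  apply rad_mul_le_rad; [apply mat_good|apply f_good].
Qed.

(** The discs are nested, so [disc_sub_disc] applies; as the radii converge, this makes the centres
    Cauchy. *)
Lemma ctr_mat_dist m n : (m <= n)%nat -> Cmod (Csub (c n) (c m)) <= r m - r n.
Proof.
  intro Hmn. apply disc_sub_disc; [left; apply good_rad, mat_good|].
  induction Hmn as [|n _ IH]; [auto|]. intros w Hw. apply IH.
  apply in_image_iff in Hw. destruct Hw as [z [Hz E]].
  apply in_image_iff. exists (app (f (S n)) z). split; [apply good_app; trivial|].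
  change (comp_app f n (mob_app (f (S n)) (Some z)) = Some w) in E.
  rewrite mob_app_den in E by (apply good_den; trivial). exact E.
Qed.

Lemma rad_mat_cv : exists l, Un_cv r l /\ forall n, l <= r n.
Proof.
  destruct (decreasing_cv r) as [l Hl].
  - intro n; apply rad_mat_decr; lia.
  - exists 0. intros x [n ->]. unfold opp_seq.
    assert (0 < r n) by apply good_rad, mat_good. lra.
  - exists l; split; trivial. intro n. apply (decreasing_ineq r l); trivial.
    intro k; apply rad_mat_decr; lia.
Qed.

(** The limit disc lies in every image disc, which bounds the radii below. Conversely the centres
    converge and the radii tend to some l > 0; the intersection is the disc of radius l about the
    limit centre. *)
Lemma limit_disc_iff : limit_disc f <-> exists s, 0 < s /\ forall n, s <= r n.
Proof.
  split.
  - intros [c0 [s [Hs H]]]. exists s; split; trivial.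
    assert (H1 : forall n, s <= r (S n)).
    { intro n.
      cut (Cmod (Csub c0 (c (S n))) <= r (S n) - s); [generalize (Cmod_ge0 (Csub c0 (c (S n)))); lra|].
      apply disc_sub_disc; [lra|]. intros w Hw. apply in_image_iff.
      apply (proj2 (H w) Hw); lia. }
    (* The intersection runs over n >= 1; index 0 follows because the radii decrease. *)
    intro n. apply Rle_trans with (1 := H1 n), rad_mat_decr; lia.
  - intros [s [Hs H]]. destruct rad_mat_cv as [l [Hl Hle]].
    assert (Hsl : s <= l).
    { apply Rnot_lt_le; intro Hlt. destruct (Hl (s - l) ltac:(lra)) as [n Hn].
      specialize (Hn n ltac:(lia)). specialize (H n). unfold R_dist in Hn.
      apply Rabs_def2 in Hn; lra. }
    assert (Cau : forall e, e > 0 -> exists N, forall n m, (n >= N)%nat -> (m >= N)%nat ->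
      Cmod (Csub (c n) (c m)) < e).
    { intros e He. destruct (Hl (e / 2) ltac:(lra)) as [N HN]. exists N.
      intros n m Hn Hm. specialize (HN N ltac:(lia)). unfold R_dist in HN.
      apply Rabs_def2 in HN.
      assert (T := Cmod_sub_triangle (c n) (c N) (c m)).
      rewrite (Cmod_subC (c N) (c m)) in T.
      assert (D1 := ctr_mat_dist N n ltac:(lia)). assert (D2 := ctr_mat_dist N m ltac:(lia)).
      assert (L1 := Hle n). assert (L2 := Hle m). lra. }
    destruct (R_complete (fun n => fst (c n))) as [x Hx].
    { intros e He. destruct (Cau e He) as [N HN]. exists N. intros n m Hn Hm.
      apply Rle_lt_trans with (2 := HN n m Hn Hm).
      exact (proj1 (coord_le (Csub (c n) (c m)))). }
    destruct (R_complete (fun n => snd (c n))) as [y Hy].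
    { intros e He. destruct (Cau e He) as [N HN]. exists N. intros n m Hn Hm.
      apply Rle_lt_trans with (2 := HN n m Hn Hm).
      exact (proj2 (coord_le (Csub (c n) (c m)))). }
    assert (Hc : forall e, e > 0 -> exists N, forall n, (n >= N)%nat ->
      Cmod (Csub (c n) (x, y)) < e /\ r n < l + e).
    { intros e He. destruct (Hx (e / 2) ltac:(lra)) as [N1 H1].
      destruct (Hy (e / 2) ltac:(lra)) as [N2 H2]. destruct (Hl e He) as [N3 H3].
      exists (N1 + N2 + N3)%nat. intros n Hn.
      specialize (H1 n ltac:(lia)). specialize (H2 n ltac:(lia)). specialize (H3 n ltac:(lia)).
      unfold R_dist in H1, H2, H3. apply Rabs_def2 in H3. split; [|lra].
      apply Rle_lt_trans with (1 := Cmod_le_coord _).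
      change (Rabs (fst (c n) - x) + Rabs (snd (c n) - y) < e). lra. }
    exists (x, y), l. split; [lra|]. intro w. split.
    + intro Hw. apply le_epsilon. intros e He.
      destruct (Hc (e / 2) ltac:(lra)) as [N HN]. destruct (HN (S N) ltac:(lia)) as [D1 D2].
      assert (D3 := proj1 (in_image_iff _ _) (Hw (S N) ltac:(lia))).
      assert (T := Cmod_sub_triangle w (c (S N)) (x, y)). lra.
    (* Index N + n is both close to the limit and nested in disc n: |w - c_n| <= l + e + (r_n -
       r_(N+n)) <= r_n + e. *)
    + intros Hw n _. apply in_image_iff. apply le_epsilon. intros e He.
      destruct (Hc e He) as [N HN]. destruct (HN (N + n)%nat ltac:(lia)) as [D1 D2].
      assert (D3 := ctr_mat_dist n (N + n) ltac:(lia)).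
      assert (T := Cmod_sub_triangle w (x, y) (c n)).
      assert (T' := Cmod_sub_triangle (x, y) (c (N + n)%nat) (c n)).
      rewrite (Cmod_subC (x, y) (c (N + n)%nat)) in T'.
      assert (L := Hle (N + n)%nat). lra.
Qed.

End Composition.

(** * Uniform bounds on a finite set and comparison with a series *)

Lemma finite_pos_lower_bound {A : Type} (l : list A) (P : A -> Prop) (phi : A -> R) :
  (forall x, In x l -> P x -> 0 < phi x) ->
  exists m, 0 < m /\ forall x, In x l -> P x -> m <= phi x.
Proof.
  induction l as [|a l IH]; intro H.
  - exists 1; split; [lra|]. intros x [].
  - destruct IH as [m [Hm IH]]; [intros; apply H; simpl; auto|].
    destruct (classic (P a)) as [Pa|Pa].
    + exists (Rmin m (phi a)). split; [apply Rmin_glb_lt; trivial; apply H; simpl; auto|].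
      intros x [<-|Hx] Px; [apply Rmin_r|].
      apply Rle_trans with m; [apply Rmin_l|auto].
    + exists m; split; trivial. intros x [<-|Hx] Px; [contradiction|auto].
Qed.

(** Telescoping traps the growth of [x] between multiples of the growth of the partial sums, which
    increase and so converge once bounded. *)
Lemma comparable_increments_bounded_iff (x g : nat -> R) (m M : R) (k : nat) :
  0 < m -> 0 <= M -> (forall n, 0 <= g n) ->
  (forall n, (k <= n)%nat -> m * g n <= x (S n) - x n <= M * g n) ->
  (exists X, forall n, x n <= X) <->
  exists l, Un_cv (fun N => sum_f_R0 (fun i => g (S i)) N) l.
Proof.
  intros Hm HM Hg H. set (s := fun N => sum_f_R0 (fun i => g (S i)) N).
  assert (Hs : Un_growing s) by (intro n; unfold s; simpl; generalize (Hg (S (S n))); lra).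
  (* The last term of [s N] is [g (S N)], so the difference of partial sums runs over [g] from k + 2
     to k + n + 1; hence the shift by two in [x]. *)
  assert (I : forall n, m * (s (k + n)%nat - s k) <= x (S (S (k + n))) - x (S (S k))
                        <= M * (s (k + n)%nat - s k)).
  { induction n as [|n IH]; [rewrite Nat.add_0_r; split; lra|].
    rewrite Nat.add_succ_r. specialize (H (S (S (k + n))) ltac:(lia)).
    replace (s (S (k + n))) with (s (k + n)%nat + g (S (S (k + n)))) by reflexivity. lra. }
  split.
  - intros [X HX]. destruct (growing_cv s Hs) as [l Hl]; [|exists l; exact Hl].
    exists (s k + (X - x (S (S k))) / m). intros y [n ->].
    apply Rle_trans with (s (k + n)%nat).
    + apply Rge_le, (growing_prop s); trivial; lia.
    + specialize (I n). specialize (HX (S (S (k + n)))).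
      apply Rmult_le_reg_l with m; trivial.
      replace (m * (s k + (X - x (S (S k))) / m)) with (m * s k + (X - x (S (S k)))) by (field; lra).
      lra.
  - intros [l Hl].
    assert (Hx : forall j n, (j <= n)%nat -> (k <= j)%nat -> x j <= x n).
    { induction 1 as [|n Hn IH]; intro Hk; [lra|].
      specialize (IH Hk). specialize (H n ltac:(lia)). specialize (Hg n). nra. }
    assert (HX : forall n, x (S (S (k + n))) <= x (S (S k)) + M * (l - s k)).
    { intro n. specialize (I n). assert (G := growing_ineq s l Hs Hl (k + n)%nat). nra. }
    (* The increments are controlled only from [k] on, so the earlier values are bounded
       separately. *)
    assert (Hfin : exists Y, forall n, (n <= k)%nat -> x n <= Y).
    { clear. induction k as [|k [Y HY]].
      - exists (x O). intros n Hn. replace n with O by lia. lra.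
      - exists (Rmax Y (x (S k))). intros n Hn.
        destruct (Nat.eq_dec n (S k)) as [->|]; [apply Rmax_r|].
        apply Rle_trans with Y; [apply HY; lia|apply Rmax_l]. }
    destruct Hfin as [Y HY]. exists (Rmax Y (x (S (S k)) + M * (l - s k))). intro n.
    destruct (Nat.le_gt_cases n k) as [Hn|Hn].
    + apply Rle_trans with (1 := HY n Hn), Rmax_l.
    + apply Rle_trans with (2 := Rmax_r _ _). apply Rle_trans with (2 := HX n).
      apply Hx; lia.
Qed.

(** * The two conditions for a sequence drawn from a finite family *)

Section Family.

Variable Fam : list mob.
Hypothesis Fam_MD : forall g, In g Fam -> in_MD g.
Variable f : nat -> mob.
Hypothesis f_Fam : forall n, (1 <= n)%nat -> In (f n) Fam.

Let f_MD n : in_MD (f (S n)).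
Proof. apply Fam_MD, f_Fam; lia. Qed.

Let f_good n : good (f (S n)).
Proof. apply in_MD_good, f_MD. Qed.

Local Notation r := (disc_rad f).

Let r_gt0 n : 0 < r n.
Proof. apply good_rad, mat_good, f_good. Qed.

(** A match forces both maps to be tangent: otherwise [beta] is infinity or [alpha] is 0, while a
    finite [beta] has modulus 1. *)
Definition matched : Prop :=
  exists N, forall n, (N <= n)%nat -> (2 <= n)%nat -> Some (alpha (f (n - 1))) = beta (f n).

Lemma limit_disc_matched : limit_disc f -> matched.
Proof.
  intro HL. apply (limit_disc_iff f f_good) in HL. destruct HL as [s [Hs HL]].
  apply NNPP; intro HN.
  assert (Bad : forall N, exists n, (N <= n)%nat /\ Some (alpha (f (S n))) <> beta (f (S (S n)))).
  { intro N. apply NNPP; intro H. apply HN. exists (S (S N)). intros n Hn _.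
    apply NNPP; intro E. apply H. exists (n - 2)%nat. split; [lia|].
    replace (S (n - 2)) with (n - 1)%nat by lia.
    replace (S (n - 1)) with n by lia. exact E. }
  (* Finitely many mismatched pairs: [1 - m] is the common contraction factor rho. *)
  destruct (finite_pos_lower_bound (list_prod Fam Fam)
    (fun p => Some (alpha (fst p)) <> beta (snd p))
    (fun p => 1 - (Cmod (ctr (mob_mul (fst p) (snd p))) + rad (mob_mul (fst p) (snd p)))))
    as [m [Hm Hbound]].
  { intros [g h] Hin Hne. apply in_prod_iff in Hin.
    assert (B := mismatch_compact_image g h (Fam_MD _ (proj1 Hin)) (Fam_MD _ (proj2 Hin)) Hne).
    simpl; lra. }
  assert (Step : forall n, Some (alpha (f (S n))) <> beta (f (S (S n))) ->
    r (S (S n)) <= (1 - m) * r n).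
  { intros n Hne. specialize (Hbound (f (S n), f (S (S n)))).
    specialize (Hbound ltac:(apply in_prod; apply f_Fam; lia) Hne). simpl in Hbound.
    assert (Hgh : good (mob_mul (f (S n)) (f (S (S n))))) by (apply good_mul; apply f_good).
    assert (E := rad_mul_le (mat f n) _ (mat_good f f_good n) Hgh).
    replace (r (S (S n))) with (rad (mob_mul (mat f n) (mob_mul (f (S n)) (f (S (S n)))))).
    - fold (r n) in E. specialize (r_gt0 n). nra.
    - unfold disc_rad; simpl. f_equal. unfold mob_mul; simpl; f_equal; ring. }
  assert (Hm1 : 0 <= 1 - m).
  { destruct (Bad O) as [n [_ Hn]]. specialize (Step n Hn).
    assert (H1 := r_gt0 n). assert (H2 := r_gt0 (S (S n))). nra. }
  (* Each further mismatch, taken at some k >= n, contributes one more factor [1 - m]. *)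
  assert (Pow : forall j, exists n, r n <= (1 - m) ^ j * r O).
  { induction j as [|j [n IH]]; [exists O; simpl; lra|].
    destruct (Bad n) as [k [Hk Hne]]. exists (S (S k)).
    apply Rle_trans with (1 := Step k Hne). simpl. rewrite Rmult_assoc.
    apply Rmult_le_compat_l; trivial.
    apply Rle_trans with (2 := IH). apply rad_mat_decr; trivial. }
  assert (H0 := r_gt0 O).
  destruct (pow_lt_1_zero (1 - m) ltac:(rewrite Rabs_right; lra) (s / r O)
    ltac:(apply Rdiv_lt_0_compat; lra)) as [J HJ].
  specialize (HJ J ltac:(lia)). destruct (Pow J) as [n Hn]. specialize (HL n).
  assert (Hp : (1 - m) ^ J < s / r O) by (apply Rle_lt_trans with (2 := HJ), Rle_abs).
  apply Rmult_lt_compat_r with (r := r O) in Hp; trivial.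
  replace (s / r O * r O) with s in Hp by (field; lra). lra.
Qed.

Lemma gprod_gt0 n : 0 < gprod f n.
Proof.
  induction n; simpl; [lra|]. apply Rmult_lt_0_compat; trivial. apply gamma_gt0, f_good.
Qed.

(** By the chain rule at [alpha (f (S n))], which [f (S n)] sends to its [beta], equal to
    [alpha (f n)], passing from n to n + 1 multiplies the left-hand side by [gamma (f (S n))]. *)
Lemma matched_inv_deriv : matched -> exists k K, 0 < K /\
  forall n, (k <= n)%nat -> exists b, beta (f (S n)) = Some b /\
    inv_deriv (mat f n) b = K * gprod f n.
Proof.
  (* For n >= [S N] the index [S n] is at least 2, as [matched] requires. *)
  intros [N HN]. set (k := S N).
  assert (Hb : forall n, (k <= n)%nat -> beta (f (S n)) = Some (alpha (f n))).
  { intros n Hn. rewrite <- HN by (unfold k in Hn; lia). do 3 f_equal; lia. }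
  set (K := inv_deriv (mat f k) (alpha (f k)) / gprod f k).
  assert (Gk := gprod_gt0 k).
  exists k, K. split.
  { apply Rdiv_lt_0_compat; trivial.
    apply inv_deriv_gt0; [apply mat_good, f_good|apply Cmod_alpha_le1]. }
  intros n Hn. exists (alpha (f n)). split; [apply Hb, Hn|].
  induction Hn as [|n Hn IH]; [unfold K; field; lra|].
  assert (D := good_den _ _ (f_good n) (Cmod_alpha_le1 (f (S n)))).
  simpl mat. rewrite inv_deriv_mul by (trivial; apply mat_good, f_good).
  destruct (beta_Some _ _ (Hb n Hn)) as [_ [_ E]]. apply mob_app_Some in E.
  rewrite (proj2 E), IH. simpl gprod. rewrite gamma_eq by trivial. unfold inv_deriv; ring.
Qed.

Lemma matched_limit_disc_iff : matched ->
  (limit_disc f <-> exists l, Un_cv (fun N => sum_f_R0 (fun k => gprod f (S k)) N) l).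
Proof.
  intro HM. destruct (matched_inv_deriv HM) as [k [K [HK Hk]]].
  assert (Fr : forall g, In g Fam -> 0 < rad g < 1).
  { intros g Hg; split; [apply good_rad, in_MD_good|apply in_MD_rad_lt1]; auto. }
  destruct (finite_pos_lower_bound Fam (fun _ => True) rad) as [p [Hp Lp]].
  { intros g Hg _; apply Fr, Hg. }
  destruct (finite_pos_lower_bound Fam (fun _ => True) (fun g => 1 - rad g)) as [q [Hq Lq]].
  { intros g Hg _. specialize (Fr g Hg); lra. }
  (* The increments of 1/r_n are (1/s - 1) K [gprod f n] with s the radius of f_(n+1)(D); from s >=
     p and 1 - s >= q follows q <= 1/s - 1 <= 1/p. *)
  rewrite <- (comparable_increments_bounded_iff (fun n => / r n) (gprod f) (q * K) (/ p * K) k).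
  - rewrite (limit_disc_iff f f_good). split.
    + intros [s [Hs H]]. exists (/ s). intro n. apply Rinv_le_contravar; auto.
    + intros [X HX]. assert (HX0 : 0 < X).
      { apply Rlt_le_trans with (2 := HX O), Rinv_0_lt_compat, r_gt0. }
      exists (/ X). split; [apply Rinv_0_lt_compat, HX0|]. intro n.
      rewrite <- (Rinv_inv (r n)). apply Rinv_le_contravar; [apply Rinv_0_lt_compat, r_gt0|apply HX].
  - apply Rmult_lt_0_compat; trivial.
  - left; apply Rmult_lt_0_compat; trivial. apply Rinv_0_lt_compat, Hp.
  - intro n; left; apply gprod_gt0.
  - intros n Hn. destruct (Hk n Hn) as [b [Hb E]].
    assert (HF : In (f (S n)) Fam) by (apply f_Fam; lia).
    replace (/ r (S n)) with (/ r n + (/ rad (f (S n)) - 1) * (K * gprod f n)).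
    2:{ rewrite <- E. unfold disc_rad; simpl mat. symmetry.
        apply rad_mul_tangent_inv; trivial. apply mat_good, f_good. }
    specialize (Fr _ HF). specialize (Lp _ HF I). specialize (Lq _ HF I).
    assert (HKg : 0 < K * gprod f n) by (apply Rmult_lt_0_compat; trivial; apply gprod_gt0).
    assert (A : / rad (f (S n)) <= / p) by (apply Rinv_le_contravar; trivial).
    assert (B : q <= / rad (f (S n)) - 1).
    { apply Rmult_le_reg_l with (rad (f (S n))); [lra|].
      rewrite Rmult_minus_distr_l, Rinv_r by lra. nra. }
    split; nra.
Qed.

End Family.

Theorem theorem1p2 :
  forall (Fam : list mob),
    (forall g, In g Fam -> in_MD g) ->
  forall (f : nat -> mob),
    (forall n, (1 <= n)%nat -> In (f n) Fam) ->
    (limit_disc f <->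
      ((exists N : nat, forall n : nat, (N <= n)%nat -> (2 <= n)%nat ->
          Some (alpha (f (n - 1)%nat)) = beta (f n)) /\
       (exists l : R,
          Un_cv (fun N => sum_f_R0 (fun k => gprod f (S k)) N) l))).
Proof.
  intros Fam HF f Hf. fold (matched f). split.
  - intro H. assert (HM := limit_disc_matched Fam HF f Hf H).
    split; trivial. apply (matched_limit_disc_iff Fam HF f Hf HM), H.
  - intros [HM HS]. apply (matched_limit_disc_iff Fam HF f Hf HM), HS.
Qed.
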